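(* For integers $m\ge 3$ and $n\ge 7$, \[ \left\lceil\frac{n+1}{3}\right\rceil(m+2)-2\;\le\;\gamma^{\mathrm{SID}}(K_m\times P_n)\;\le\;\left\lceil\frac{n+1}{3}\right\rceil(m+3)+m. \]
   Context: For a vertex $v$, $N[v]$ is its closed neighborhood. A nonempty set $S\subseteq V(G)$ is a self-identifying code of $G$ if for every vertex $v\in V(G)$: (1) $N[v]\cap S\neq\emptyset$, and (2) $\bigcap_{c\in N[v]\cap S}N[c]=\{v\}$; $\gamma^{\mathrm{SID}}(G)$ is the minimum size of such a code. With $V(K_m)=\{v_0,\dots,v_{m-1}\}$ and $V(P_n)=\{0,\dots,n-1\}$ (consecutively numbered path), the direct product $K_m\times P_n$ has vertices $(v_i,j)$, with $(v_i,j)$ adjacent to $(v_{i'},j')$ iff $i\neq i'$ and $|j-j'|=1$. *)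

(* Defs.v *)
From mathcomp Require Import all_boot.
From mathcomp Require Import zify.
Set Implicit Arguments.
Unset Strict Implicit.
Unset Printing Implicit Defensive.

Record sgraph := SGraph {
  vertex :> finType;
  edge : rel vertex;
  edge_sym : symmetric edge;
  edge_irr : irreflexive edge
}.

Definition closed_nbhd (G : sgraph) (v : G) : {set G} :=
  [set u | (u == v) || edge v u].

Definition self_identifying_code (G : sgraph) (S : {set G}) : bool :=
  (S != set0) &&
  [forall v : G,
     (closed_nbhd v :&: S != set0) &&
     (\bigcap_(c in closed_nbhd v :&: S) closed_nbhd c == [set v])].

(* A superset of a code is a code, so [setT] is a code as soon as there is one,
   and the arg min is then a code of minimum size (gammaSIDP). Its value #|G|
   for a graph without codes is irrelevant. *)
Definition gammaSID (G : sgraph) : nat :=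
  #|[arg min_(S < [set: G] | self_identifying_code S) #|S| ]|.

Section Complete.
Variable m : nat.
Definition complete_rel : rel 'I_m := fun i i' => i != i'.
Lemma complete_sym : symmetric complete_rel.
Proof. by move=> i i'; rewrite /complete_rel eq_sym. Qed.
Lemma complete_irr : irreflexive complete_rel.
Proof. by move=> i; rewrite /complete_rel eqxx. Qed.
Definition complete_graph : sgraph := SGraph complete_sym complete_irr.
End Complete.

Section Path.
Variable n : nat.
Definition path_rel : rel 'I_n := fun j j' => (j.+1 == j' :> nat) || (j'.+1 == j :> nat).
Lemma path_sym : symmetric path_rel.
Proof. by move=> j j'; rewrite /path_rel orbC. Qed.
Lemma path_irr : irreflexive path_rel.
Proof. by move=> j; rewrite /path_rel orbb; lia. Qed.
Definition path_graph : sgraph := SGraph path_sym path_irr.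
End Path.

Section DirectProduct.
Variables G H : sgraph.
Definition direct_product_rel : rel (G * H) :=
  fun x y => edge x.1 y.1 && edge x.2 y.2.
Lemma direct_product_sym : symmetric direct_product_rel.
Proof. by move=> x y; rewrite /direct_product_rel edge_sym [edge x.2 _]edge_sym. Qed.
Lemma direct_product_irr : irreflexive direct_product_rel.
Proof. by move=> x; rewrite /direct_product_rel edge_irr. Qed.
Definition direct_product : sgraph :=
  SGraph direct_product_sym direct_product_irr.
End DirectProduct.

Lemma closed_nbhd_sym (G : sgraph) (u v : G) :
  (u \in closed_nbhd v) = (v \in closed_nbhd u).
Proof. by rewrite !inE eq_sym edge_sym. Qed.

Lemma self_identifying_codeS (G : sgraph) (S S' : {set G}) :
  S \subset S' -> self_identifying_code S -> self_identifying_code S'.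
Proof.
move=> sSS' /andP[S0 /forallP cS]; apply/andP; split.
  by apply: contraNneq S0 => S'0; rewrite -subset0 -S'0.
apply/forallP => v; have /andP[N0 /eqP NI] := cS v.
have sN : closed_nbhd v :&: S \subset closed_nbhd v :&: S' by apply: setIS.
apply/andP; split.
  by apply: contraNneq N0 => N'0; rewrite -subset0 -N'0.
rewrite eqEsubset; apply/andP; split.
  rewrite -NI; apply/bigcapsP => c cN.
  by apply: bigcap_inf; apply: (subsetP sN).
rewrite sub1set; apply/bigcapP => c /setIP[cv _].
by rewrite closed_nbhd_sym.
Qed.

Lemma gammaSIDP (G : sgraph) (S0 : {set G}) : self_identifying_code S0 ->
  (exists2 S : {set G}, self_identifying_code S & #|S| = gammaSID G) /\
  (forall S : {set G}, self_identifying_code S -> gammaSID G <= #|S|).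
Proof.
move=> /(self_identifying_codeS (subsetT _)) cT; rewrite /gammaSID.
by case: arg_minnP => // S cS minS; split=> //; exists S.
Qed.

Lemma code_complete_path (m n : nat) : 2 < m -> 1 < n ->
  @self_identifying_code
    (direct_product (complete_graph m) (path_graph n)) setT.
Proof.
move=> m3 n2; set G := direct_product _ _.
have other (i i' : 'I_m) : exists k : 'I_m, (k != i) && (k != i').
  have : 0 < #|~: [set i; i']|.
    rewrite -(leq_add2l #|[set i; i']|) cardsC card_ord cards2.
    by case: (i != i') => //=; lia.
  by case/card_gt0P => k; rewrite !inE negb_or; exists k.
have nb (j : 'I_n) : exists j' : 'I_n, path_rel j j'.
  case: (ltnP j.+1 n) => [h|h]; first by exists (Ordinal h); rewrite /path_rel /= eqxx.
  have h' : j.-1 < n by have := ltn_ord j; lia.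
  by exists (Ordinal h'); rewrite /path_rel /=; have := ltn_ord j; lia.
apply/andP; split.
  apply/set0Pn.
  by exists (Ordinal (ltnW (ltnW m3)), Ordinal (ltnW n2)); rewrite inE.
apply/forallP => v; rewrite setIT; apply/andP; split.
  by apply/set0Pn; exists v; rewrite !inE eqxx.
rewrite eqEsubset sub1set; apply/andP; split; last first.
  by apply/bigcapP => c; rewrite closed_nbhd_sym.
apply/subsetP => x /bigcapP xP.
have := xP v; rewrite !inE eqxx => /(_ isT) /orP[//|].
case: v xP => i j xP; case: x xP => i' j' xP /andP /= [ii' jj'].
have [k /andP[ki ki']] := other i i'.
have := xP (k, j'); rewrite !inE /edge /= /direct_product_rel /= {1}/complete_rel.
rewrite jj' [i == k]eq_sym ki orbT => /(_ isT).
rewrite path_irr andbF orbF.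
by rewrite xpair_eqE eqxx andbT eq_sym (negPf ki').
Qed.

(* Main.v *)
Require Import Defs.
From mathcomp Require Import all_boot all_order all_algebra.
From mathcomp Require Import zify.

(** A vertex [(i, j)] lies in a self-identifying code with layers [L j] or its
    two neighbouring layers together cover all indices but [i], and each of them
    (when there is a layer beyond the opposite one) meets the complement of [i];
    moreover every vertex has two code neighbours.  Hence both end layers are
    full, their neighbours have at least 3 elements, and any three consecutive
    layers away from the ends contain at least [m + 2] code vertices: if the
    middle one is a singleton [{x}], then [x] belongs to both outer layers, which
    cover all indices.  Splitting the path into such triples, with two or four
    layers at the ends, gives the lower bound.  For the upper bound, every third
    layer is full and the two layers in between have 2 and 1 elements. *)

Set Implicit Arguments.
Unset Strict Implicit.
Unset Printing Implicit Defensive.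

(** * Codes as separating sets *)

Lemma self_identifying_code_separates (G : sgraph) (S : {set G}) (v u : G) :
  self_identifying_code S -> u != v ->
  exists c, [/\ c \in S, c \in closed_nbhd v & c \notin closed_nbhd u].
Proof.
move=> /andP[_ /forallP/(_ v) /andP[_ /eqP capv]] uv.
have [/existsP[c /and3P[]]|/existsPn nosep] :=
  boolP [exists c, [&& c \in S, c \in closed_nbhd v & c \notin closed_nbhd u]].
  by exists c.
(* Without a separating code vertex, all of [closed_nbhd v :&: S] lies in the closed neighborhood of
   [u], so by symmetry [u] belongs to the intersection [[set v]]. *)
suff : u \in \bigcap_(c in closed_nbhd v :&: S) closed_nbhd c.
  by rewrite capv inE (negPf uv).
apply/bigcapP => c /setIP[cv cS]; rewrite closed_nbhd_sym.
by have := nosep c; rewrite cS cv /= negbK.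
Qed.

Lemma separates_self_identifying_code (G : sgraph) (S : {set G}) :
  S != set0 -> (forall v, closed_nbhd v :&: S != set0) ->
  (forall v u, u != v ->
     exists c, [/\ c \in S, c \in closed_nbhd v & c \notin closed_nbhd u]) ->
  self_identifying_code S.
Proof.
move=> S0 dom sep; rewrite /self_identifying_code S0 /=.
apply/forallP => v; rewrite dom eqEsubset sub1set /=.
apply/andP; split; last by apply/bigcapP => c /setIP[]; rewrite closed_nbhd_sym.
apply/subsetP => u /bigcapP uP; rewrite inE; apply: contraT => uv.
have [c [cS cv cu]] := sep v u uv.
by rewrite closed_nbhd_sym uP // in_setI cv in cu.
Qed.

Lemma sum_blocks3_ge (s : nat -> nat) (w p q : nat) :
  (forall j, p <= j -> j.+3 <= p + 3 * q -> w <= s j + s j.+1 + s j.+2) ->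
  q * w <= \sum_(p <= j < p + 3 * q) s j.
Proof.
elim: q => [|q IH] h; first by rewrite mul0n.
have -> : p + 3 * q.+1 = (p + 3 * q).+3 by lia.
rewrite !big_nat_recr /=; try lia.
have := IH (fun j pj jq => h j pj ltac:(lia)).
have := h (p + 3 * q) ltac:(lia) ltac:(lia).
lia.
Qed.

(** * Vertex sets as sequences of layers *)

Section Layers.

Variables m n : nat.
Let G := direct_product (complete_graph m) (path_graph n).

(* Layer [j] of the paper has index [j.+1] here: indices 0 and [n.+1] are free
   for the missing neighbours of the two end layers. *)
Definition code_of_layers (L : nat -> {set 'I_m}) : {set G} :=
  [set v : G | v.1 \in L (v.2 : 'I_n).+1].

Definition layers_of_code (S : {set G}) (j : nat) : {set 'I_m} :=
  [set i | [exists k : 'I_n, (k.+1 == j) && ((i, k) \in S)]].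

Lemma layers_of_codeK (S : {set G}) : code_of_layers (layers_of_code S) = S.
Proof.
apply/setP => -[i k]; rewrite !inE /=; apply/existsP/idP => [[k']|iS].
  by move=> /andP[/eqP [] /val_inj ->].
by exists k; rewrite eqxx.
Qed.

Lemma layers_of_code_first (S : {set G}) : layers_of_code S 0 = set0.
Proof. by apply/setP => i; rewrite !inE; apply/existsP => -[k]. Qed.

Lemma layers_of_code_last (S : {set G}) : layers_of_code S n.+1 = set0.
Proof.
apply/setP => i; rewrite !inE; apply/existsP => -[k /andP[/eqP [kn] _]].
by have := ltn_ord k; rewrite kn ltnn.
Qed.

Lemma card_code_of_layers (L : nat -> {set 'I_m}) :
  #|code_of_layers L| = \sum_(1 <= j < n.+1) #|L j|.
Proof.
rewrite big_add1 /= big_mkord -sum1_card.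
rewrite (eq_bigl (fun v : G => v.1 \in L (v.2 : 'I_n).+1)); last first.
  by move=> v; rewrite inE.
rewrite -(pair_big_dep xpredT (fun (i : 'I_m) (k : 'I_n) => i \in L k.+1)
            (fun _ _ => 1)) /=.
rewrite (exchange_big_dep xpredT) //=.
by apply: eq_bigr => k _; rewrite sum1_card.
Qed.

(** Layer indices are plain naturals here, so the empty layers 0 and [n.+1] can be mentioned without
    range conditions. *)
Definition closed_adj (a : 'I_m) (b : nat) (i : 'I_m) (j : nat) : bool :=
  (a == i) && (b == j) || (a != i) && ((b.+1 == j) || (j.+1 == b)).

Lemma in_closed_nbhd_product (c v : G) :
  (c \in closed_nbhd v) =
  closed_adj c.1 (c.2 : 'I_n).+1 v.1 (v.2 : 'I_n).+1.
Proof.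
case: c v => a b [i j]; rewrite inE /edge /= /direct_product_rel /=.
rewrite /edge /= /complete_rel /path_rel /closed_adj xpair_eqE !eqSS.
by rewrite (eq_sym i) -(inj_eq val_inj) (orbC (j.+1 == _ :> nat)).
Qed.

(** Each field separates (i, j) from one kind of vertex: [layer_two] from its neighbours,
    [layer_cover] from the other vertices of its own layer, [layer_prev] from (i, j + 2) and
    [layer_next] from (i, j - 2). The last three assume [i \notin L j], since otherwise (i, j)
    itself separates. *)
Record layer_code (L : nat -> {set 'I_m}) : Prop := LayerCode {
  layer_two : forall i j, 0 < j <= n ->
    2 <= #|L j.-1 :\ i| + #|L j.+1 :\ i|;
  layer_cover : forall i j, 0 < j <= n -> i \notin L j ->
    [set~ i] \subset L j.-1 :|: L j.+1;
  layer_prev : forall i j, 0 < j -> j.+2 <= n -> i \notin L j ->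
    L j.-1 :\ i != set0;
  layer_next : forall i j, 2 < j <= n -> i \notin L j ->
    L j.+1 :\ i != set0
}.

(** * Equivalence of the layer conditions with being a code *)

Section Separation.

Variable L : nat -> {set 'I_m}.
Hypotheses (L0 : L 0 = set0) (Ln1 : L n.+1 = set0).

Definition layers_separated : Prop :=
  forall i j i' j', 0 < j <= n -> 0 < j' <= n -> (i', j') != (i, j) ->
  exists a b, [/\ a \in L b, closed_adj a b i j & ~~ closed_adj a b i' j'].

Lemma code_layers_separated :
  self_identifying_code (code_of_layers L) -> layers_separated.
Proof.
move=> cS i j i' j' jn jn' ne.
have kn : j.-1 < n by lia.
have kn' : j'.-1 < n by lia.
pose v : G := (i, Ordinal kn); pose u : G := (i', Ordinal kn').
have uv : u != v.
  apply: contraNneq ne => -[-> jj]; rewrite xpair_eqE eqxx /=; lia.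
have [[a b] []] := self_identifying_code_separates cS uv.
rewrite !in_closed_nbhd_product inE /= !prednK; try lia.
by move=> *; exists a, b.+1.
Qed.

Lemma layers_separated_code : 1 < m -> 0 < n ->
  layers_separated -> (forall i j, 0 < j <= n ->
    exists a b, a \in L b /\ closed_adj a b i j) ->
  self_identifying_code (code_of_layers L).
Proof.
move=> m1 n0 sep dom.
(* Adjacency keeps [b] at most [n.+1], and the empty layers exclude 0 and [n.+1], so [(a, b)] is a
   genuine vertex. *)
have lift_vertex (a : 'I_m) b (v : G) : a \in L b ->
    closed_adj a b v.1 (v.2 : 'I_n).+1 ->
    exists2 k : 'I_n, b = k.+1 & (a, k) \in code_of_layers L.
  move=> aL adj.
  have b0 : b != 0 by apply: contraTneq aL => ->; rewrite L0 inE.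
  have bn : b != n.+1 by apply: contraTneq aL => ->; rewrite Ln1 inE.
  have kn : b.-1 < n.
    by move: adj; rewrite /closed_adj; have := ltn_ord (v.2 : 'I_n); lia.
  exists (Ordinal kn); first by rewrite /=; lia.
  by rewrite inE /= prednK //; lia.
have dom' (v : G) : closed_nbhd v :&: code_of_layers L != set0.
  have [|a [b [aL adj]]] := dom v.1 (v.2 : 'I_n).+1.
    by have := ltn_ord (v.2 : 'I_n); lia.
  have [k bk kS] := lift_vertex a b v aL adj.
  apply/set0Pn; exists (a, k); rewrite in_setI kS andbT.
  by rewrite in_closed_nbhd_product /= -bk.
apply: separates_self_identifying_code => //.
  have /set0Pn[c /setIP[_ cS]] := dom' (Ordinal (ltnW m1), Ordinal n0).
  by apply/set0Pn; exists c.
move=> v u uv.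
have [| | |a [b [aL adj nadj]]] :=
    sep v.1 (v.2 : 'I_n).+1 u.1 (u.2 : 'I_n).+1.
- by have := ltn_ord (v.2 : 'I_n); lia.
- by have := ltn_ord (u.2 : 'I_n); lia.
- by apply: contraNneq uv; case: u v => [i j] [i' j'] /= [-> /val_inj ->].
have [k bk kS] := lift_vertex a b v aL adj.
by exists (a, k); rewrite kS !in_closed_nbhd_product /= -bk.
Qed.

Lemma layers_separated_layer_code : 1 < m -> 1 < n ->
  layers_separated -> layer_code L.
Proof.
move=> m1 n1 sep.
have other (i : 'I_m) : exists i' : 'I_m, i' != i.
  have : 0 < #|[set~ i]| by rewrite cardsC1 card_ord; lia.
  by case/card_gt0P => i'; rewrite !inE; exists i'.
split.
- move=> i j jn.
  (* [(i, j)] does not separate itself from its neighbour [(i', j')], so only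
     another code neighbour of [(i, j)] can. *)
  have second i' j' : i' != i -> (j'.+1 == j) || (j.+1 == j') -> 0 < j' <= n ->
      exists a b, [/\ a \in L b, a != i, (b.+1 == j) || (j.+1 == b)
                    & (a, b) != (i', j')].
    move=> ii' jj' jn'.
    have [|a [b [aL + nadj]]] := sep i j i' j' jn jn'.
      by rewrite xpair_eqE negb_and ii'.
    rewrite /closed_adj => /orP[/andP[/eqP ai /eqP bj]|/andP[ai bj]].
      move: nadj; rewrite /closed_adj ai bj eq_sym ii' /=.
      by case/orP: jj' => /eqP <-; rewrite eqxx ?orbT //= orbT.
    exists a, b; split => //.
    apply: contraNneq nadj => -[-> ->].
    by rewrite /closed_adj !eqxx.
  have [i0 i0i] := other i.
  (* An arbitrary neighbour, taken in an existing layer, gives a first code neighbour [(a1, b1)];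
     applying [second] to that one gives a different one. *)
  have [a1 [b1 [a1L a1i b1j _]]] : exists a b, [/\ a \in L b, a != i,
      (b.+1 == j) || (j.+1 == b) & (a, b) != (i0, if j < n then j.+1 else j.-1)].
    by apply: second => //; case: (ltnP j n) => jn1; lia.
  have b1n : 0 < b1 <= n.
    have : b1 != 0 by apply: contraTneq a1L => ->; rewrite L0 inE.
    have : b1 != n.+1 by apply: contraTneq a1L => ->; rewrite Ln1 inE.
    by lia.
  have [a2 [b2 [a2L a2i b2j ne]]] := second a1 b1 a1i b1j b1n.
  have in_part a b : a \in L b -> a != i -> (b.+1 == j) || (j.+1 == b) ->
      (b == j.-1) && (a \in L j.-1 :\ i) || (b == j.+1) && (a \in L j.+1 :\ i).
    move=> aL ai /orP[]/eqP bj; apply/orP; [left|right].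
      by rewrite -bj eqxx !inE ai.
    by rewrite bj eqxx !inE ai.
  have two (A : {set 'I_m}) : a1 \in A -> a2 \in A -> a2 != a1 -> 2 <= #|A|.
    move=> A1 A2 a12; apply: leq_trans (subset_leq_card (_ : [set a2; a1] \subset A)).
      by rewrite cards2 a12.
    by apply/subsetP => x /set2P[] ->.
  have := in_part a1 b1 a1L a1i b1j; have := in_part a2 b2 a2L a2i b2j.
  move=> /orP[]/andP[/eqP e2 A2] /orP[]/andP[/eqP e1 A1].
  + by rewrite (leq_trans _ (leq_addr _ _)) // two //;
      apply: contraNneq ne => ->; rewrite e1 e2.
  + by apply: (@leq_add 1 1); apply/card_gt0P; [exists a2|exists a1].
  + by apply: (@leq_add 1 1); apply/card_gt0P; [exists a1|exists a2].
  + by rewrite (leq_trans _ (leq_addl _ _)) // two //;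
      apply: contraNneq ne => ->; rewrite e1 e2.
- move=> i j jn iL; apply/subsetP => i'; rewrite !inE => ii'.
  have [|a [b [aL adj nadj]]] := sep i j i' j jn jn.
    by rewrite xpair_eqE negb_and ii'.
  move: adj nadj; rewrite /closed_adj.
  have [ai|_] := eqVneq a i => /=.
    by rewrite orbF => /eqP bj; rewrite -ai -bj aL in iL.
  move=> bj; rewrite bj andbT; have [<-|//] := eqVneq a i'.
  by move: bj => /orP[]/eqP bj _; rewrite -?bj ?aL //= bj aL orbT.
- move=> i j j0 jn iL.
  have [|||a [b [aL adj nadj]]] := sep i j i j.+2; try lia.
    by rewrite xpair_eqE negb_and; apply/orP; right; lia.
  move: adj nadj; rewrite /closed_adj.
  have [ai|ai] := eqVneq a i => /=.
    by rewrite orbF => /eqP bj; rewrite -ai -bj aL in iL.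
  move=> adj nadj; have bj : b = j.-1 by lia.
  by apply/set0Pn; exists a; rewrite !inE ai -bj.
- move=> i j jn iL.
  have [|||a [b [aL adj nadj]]] := sep i j i j.-2; try lia.
    by rewrite xpair_eqE negb_and; apply/orP; right; lia.
  move: adj nadj; rewrite /closed_adj.
  have [ai|ai] := eqVneq a i => /=.
    by rewrite orbF => /eqP bj; rewrite -ai -bj aL in iL.
  move=> adj nadj; have bj : b = j.+1 by lia.
  by apply/set0Pn; exists a; rewrite !inE ai -bj.
Qed.

(** The cases follow the distance between the layers [j] and [j']. From distance 2 on, (i, j) itself
    separates if it is in the code; if not, [prev] and [next] settle distance 2, and beyond that any
    code neighbour works. *)
Lemma layer_code_self_identifying : 1 < m -> 0 < n ->
  layer_code L -> self_identifying_code (code_of_layers L).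
Proof.
move=> m1 n0 [two cover prev next].
have some i j : 0 < j <= n ->
    exists a b, [/\ a \in L b, a != i & (b.+1 == j) || (j.+1 == b)].
  move=> jn; have := two i j jn.
  have [e|/set0Pn[a]] := eqVneq (L j.-1 :\ i) set0; last first.
    by rewrite !inE => /andP[ai aL] _; exists a, j.-1; split => //; lia.
  rewrite e cards0 add0n => /ltnW /card_gt0P[a].
  by rewrite !inE => /andP[ai aL]; exists a, j.+1; split => //; lia.
apply: layers_separated_code => //; last first.
  move=> i j /(some i)[a [b [aL ai bj]]]; exists a, b; split => //.
  by rewrite /closed_adj (negPf ai) bj.
move=> i j i' j' jn jn' ne.
have own : i \in L j -> ~~ closed_adj i j i' j' ->
  exists a b, [/\ a \in L b, closed_adj a b i j & ~~ closed_adj a b i' j'].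
  by move=> iL nadj; exists i, j; split => //; rewrite /closed_adj !eqxx.
have [ej|nj] := eqVneq j' j.
  have ii' : i' != i by move: ne; rewrite ej xpair_eqE eqxx andbT.
  have [iL|iL] := boolP (i \in L j).
    apply: own => //; rewrite /closed_adj ej [i == i']eq_sym (negPf ii') /=; lia.
  have /subsetP/(_ i') := cover i j jn iL.
  rewrite !inE ii' => /(_ isT) /orP[] i'L.
    by exists i', j.-1; split=> //; rewrite /closed_adj ?ej ?eqxx ?ii' //=; lia.
  by exists i', j.+1; split=> //; rewrite /closed_adj ?ej ?eqxx ?ii' //=; lia.
have [adj|nadj] := boolP ((j'.+1 == j) || (j.+1 == j')).
  have [ei|ii'] := eqVneq i' i.
    have [a [b [aL ai bj]]] := some i j jn.
    by exists a, b; rewrite /closed_adj ei (negPf ai) bj; split => //=; lia.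
  have := two i j jn.
  have far b : (b.+1 == j) || (j.+1 == b) -> b != j' -> L b :\ i != set0 ->
      exists a b, [/\ a \in L b, closed_adj a b i j & ~~ closed_adj a b i' j'].
    move=> bj bj' /set0Pn[a]; rewrite !inE => /andP[ai aL].
    exists a, b; rewrite aL /closed_adj (negPf ai) bj (negPf bj'); split=> //.
    by rewrite andbF /=; lia.
  have near : 2 <= #|L j' :\ i| ->
      exists a b, [/\ a \in L b, closed_adj a b i j & ~~ closed_adj a b i' j'].
    rewrite (cardsD1 i') => h.
    have /card_gt0P[a] : 0 < #|(L j' :\ i) :\ i'|.
      by apply: contraTT h; rewrite -leqNgt leqn0 => /eqP ->; case: (i' \in _).
    rewrite !inE => /and3P[ai' ai aL].
    by exists a, j'; rewrite aL /closed_adj (negPf ai) (negPf ai') adj; split=> //=; lia.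
  (* If the layer opposite to [j'] offers no code neighbour, both neighbours given by [two] lie in
     layer [j'], and one of them is not [(i', j')]. *)
  case/orP: adj => /eqP ej.
    have [e|ne0] := eqVneq (L j.+1 :\ i) set0; last by move=> _; apply: (far j.+1) => //; lia.
    by rewrite e cards0 addn0 (_ : j.-1 = j') //; lia.
  have [e|ne0] := eqVneq (L j.-1 :\ i) set0; last by move=> _; apply: (far j.-1) => //; lia.
  by rewrite e cards0 add0n ej.
have [iL|iL] := boolP (i \in L j).
  by apply: own => //; rewrite /closed_adj; lia.
have use b : (b.+1 == j) || (j.+1 == b) -> (b != j') && (b.+1 != j') && (j'.+1 != b) ->
    L b :\ i != set0 ->
    exists a b, [/\ a \in L b, closed_adj a b i j & ~~ closed_adj a b i' j'].
  move=> bj bj' /set0Pn[a]; rewrite !inE => /andP[ai aL].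
  by exists a, b; rewrite aL /closed_adj (negPf ai) bj; split=> //; lia.
have [e2|n2] := eqVneq j' j.+2.
  by apply: (use j.-1); [lia|lia|apply: prev => //; lia].
have [e2'|n2'] := eqVneq j'.+2 j.
  by apply: (use j.+1); [lia|lia|apply: next => //; lia].
have [a [b [aL ai bj]]] := some i j jn.
by exists a, b; rewrite aL /closed_adj (negPf ai) bj; split=> //; lia.
Qed.

End Separation.

End Layers.

(** * Lower bound: counting layers in triples *)

Lemma sum_layer_sizes_ge (m n : nat) (s : nat -> nat) : 6 < n ->
  s 1 = m -> 3 <= s 2 ->
  (forall j, 3 < j -> j + 3 <= n -> m + 2 <= s j.-1 + s j + s j.+1) ->
  3 <= s n.-1 -> s n = m ->
  2 * m + 1 <= s (n - 3) + s (n - 2) + s (n - 1) + s n ->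
  (n + 3) %/ 3 * (m + 2) <= \sum_(1 <= j < n.+1) s j + 2.
Proof.
move=> n7 h1 h2 h3 hn1 hn h4.
have blocks q : 3 * q + 4 <= n ->
    q * (m + 2) <= \sum_(3 <= j < 3 + 3 * q) s j.
  move=> qn; apply: sum_blocks3_ge => j j3 jq.
  by have := h3 j.+1; rewrite addSn /=; apply; lia.
have start N : 3 <= N ->
    \sum_(1 <= j < N) s j = s 1 + s 2 + \sum_(3 <= j < N) s j.
  by move=> N3; rewrite big_ltn 1?big_ltn ?addnA //; lia.
rewrite start; last by lia.
have nE := divn_eq n 3; have rlt := ltn_pmod n (isT : 0 < 3).
set k := n %/ 3 in nE; set r := n %% 3 in nE rlt.
have tE : (n + 3) %/ 3 = k.+1 by rewrite nE; lia.
rewrite tE.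
(* If 3 divides [n], then [k - 2] triples leave exactly four final layers, and the estimate is
   tight: (m + 3) + (k - 2)(m + 2) + (2m + 1) = (k + 1)(m + 2) - 2. *)
have [r0|r0] := posnP r.
  have := blocks (k - 2) ltac:(lia).
  have -> : 3 + 3 * (k - 2) = n - 3 by lia.
  have nE' : n.+1 = (n - 3).+4 by lia.
  rewrite nE' !big_nat_recr /=; try lia.
  have -> : (n - 3).+1 = n - 2 by lia.
  have -> : (n - 2).+1 = n - 1 by lia.
  have -> : (n - 1).+1 = n by lia.
  have [k' ->] : exists k', k = k' + 2 by exists (k - 2); lia.
  by rewrite addnK; nia.
(* Otherwise [k - 1] triples are followed by the last two layers; when [r] is 2, the layer 3k
   between them is discarded. *)
have := blocks (k - 1) ltac:(lia).
rewrite (@big_cat_nat _ _ _ (3 + 3 * (k - 1)) 3 n.+1) /=; try lia.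
rewrite (@big_cat_nat _ _ _ n.-1 (3 + 3 * (k - 1)) n.+1) /=; try lia.
have -> : \sum_(n.-1 <= j < n.+1) s j = s n.-1 + s n.
  by rewrite big_ltn 1?big_ltn ?big_geq ?addn0 ?prednK //; lia.
have [k' ->] : exists k', k = k' + 1 by exists (k - 1); lia.
by rewrite addnK; nia.
Qed.

Section LowerBound.

Variables (m n : nat) (L : nat -> {set 'I_m}).
Hypotheses (m3 : 2 < m) (n7 : 6 < n).
Hypotheses (L0 : L 0 = set0) (Ln1 : L n.+1 = set0) (codeL : layer_code n L).

Lemma full_layer (j : nat) : (forall i, i \in L j) -> #|L j| = m.
Proof.
by move=> h; rewrite (eqP (_ : L j == setT)) ?cardsT ?card_ord // -subTset;
  apply/subsetP => i _.
Qed.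

(** A vertex (i, 1) outside the code has no neighbour in an earlier layer, so nothing would separate
    it from (i, 3). *)
Lemma first_layer_full : #|L 1| = m.
Proof.
apply: full_layer => i; apply: contraT => iL.
have := layer_prev codeL (ltn0Sn 0) (ltac:(lia) : 3 <= n) iL.
by rewrite L0 set0D eqxx.
Qed.

Lemma last_layer_full : #|L n| = m.
Proof.
apply: full_layer => i; apply: contraT => iL.
have := layer_next codeL (ltac:(lia) : 2 < n <= n) iL.
by rewrite Ln1 set0D eqxx.
Qed.

(* Deleting from both sets an element of one of them leaves at least two. *)
Lemma neighbor_layers_ge3 (j : nat) : 0 < j <= n ->
  3 <= #|L j.-1| + #|L j.+1|.
Proof.
move=> jn; have i0 : 'I_m by exists 0; lia.
have [k kL] : exists k, k \in L j.-1 :|: L j.+1.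
  have := layer_two codeL i0 jn.
  have [e|/set0Pn[k]] := eqVneq (L j.-1 :\ i0) set0; last first.
    by rewrite !inE => /andP[_ kL] _; exists k; rewrite inE kL.
  rewrite e cards0 add0n => /ltnW /card_gt0P[k].
  by rewrite !inE => /andP[_ kL]; exists k; rewrite inE kL orbT.
have := layer_two codeL k jn.
rewrite (cardsD1 k (L j.-1)) (cardsD1 k (L j.+1)).
move: kL; rewrite inE => /orP[] ->.
  by move=> h; rewrite -addnA add1n ltnS (leq_trans h) // leq_add2l leq_addl.
by move=> h; rewrite addnCA add1n ltnS (leq_trans h) // leq_add2r leq_addl.
Qed.

Lemma second_layer_ge3 : 3 <= #|L 2|.
Proof. by have := @neighbor_layers_ge3 1 ltac:(lia); rewrite L0 cards0. Qed.

Lemma penultimate_layer_ge3 : 3 <= #|L n.-1|.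
Proof.
by have := @neighbor_layers_ge3 n ltac:(lia); rewrite Ln1 cards0 addn0.
Qed.

(** At least two indices are missing from [L j], so each [k] differs from some missing [i], and
    [layer_cover] at that [i] covers [k]. *)
Lemma neighbor_layers_cover (j : nat) : 0 < j <= n -> #|L j| + 2 <= m ->
  L j.-1 :|: L j.+1 = setT.
Proof.
move=> jn sj; apply/eqP; rewrite -subTset; apply/subsetP => k _.
have /card_gt0P[i] : 0 < #|~: L j :\ k|.
  have := cardsC (L j); rewrite card_ord (cardsD1 k (~: L j)).
  by have := leq_b1 (k \in ~: L j); move: (nat_of_bool _) => b; lia.
rewrite !inE => /andP[ik iL].
by have /subsetP/(_ k) := layer_cover codeL jn iL; rewrite !inE eq_sym => ->.
Qed.

(** The range of [j] is the one where [layer_next] applies to layer [j.-1] and [layer_prev] to layer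
    [j.+1]. A middle layer of size at least m - 1 needs only three more vertices outside it; one of
    size 2 to m - 2 has outer layers covering all m indices; an empty one forces both outer layers
    to be full. *)
Lemma three_layers_ge (j : nat) : 3 < j -> j + 3 <= n ->
  m + 2 <= #|L j.-1| + #|L j| + #|L j.+1|.
Proof.
move=> j4 jn; have jn' : 0 < j <= n by lia.
have ge3 := neighbor_layers_ge3 jn'.
have [sj|sj] := leqP (#|L j| + 2) m; last by lia.
have cup : #|L j.-1| + #|L j.+1| = m + #|L j.-1 :&: L j.+1|.
  by rewrite -cardsUI neighbor_layers_cover // cardsT card_ord.
have before i : i \notin L j.-1 -> L j :\ i != set0.
  move=> iL; have := layer_next codeL (ltac:(lia) : 2 < j.-1 <= n) iL.
  by rewrite prednK //; lia.
have after i : i \notin L j.+1 -> L j :\ i != set0.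
  by apply: (layer_prev codeL) => //; lia.
have [s0|s0] := posnP #|L j|.
  have e0 i : L j :\ i = set0 by rewrite (cards0_eq s0) set0D.
  have -> : #|L j.-1| = m.
    by apply: full_layer => i; apply: contraT => /before; rewrite e0 eqxx.
  have -> : #|L j.+1| = m.
    by apply: full_layer => i; apply: contraT => /after; rewrite e0 eqxx.
  by lia.
have [/eqP/cards1P[x Lx]|s1] := eqVneq #|L j| 1; last by lia.
suff : 0 < #|L j.-1 :&: L j.+1| by lia.
apply/card_gt0P; exists x; rewrite inE.
apply/andP; split; apply: contraT.
  by move=> /before; rewrite Lx setDv eqxx.
by move=> /after; rewrite Lx setDv eqxx.
Qed.

(** As [layer_prev] does not reach layer n - 1, a nonempty layer n - 2 missing at least two indices
    is only counted as one vertex, on top of m for its two neighbours and m for the full last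
    layer. *)
Lemma last_four_layers_ge :
  2 * m + 1 <= #|L (n - 3)| + #|L (n - 2)| + #|L (n - 1)| + #|L n|.
Proof.
have p3 : 3 <= #|L (n - 1)| by rewrite subn1 penultimate_layer_ge3.
rewrite last_layer_full.
have [s0|s0] := posnP #|L (n - 2)|.
  have -> : #|L (n - 3)| = m; last by lia.
  apply: full_layer => i; apply: contraT => iL.
  have := layer_next codeL (ltac:(lia) : 2 < n - 3 <= n) iL.
  by rewrite (_ : (n - 3).+1 = n - 2) ?(cards0_eq s0) ?set0D ?eqxx //; lia.
have [sj|sj] := leqP (#|L (n - 2)| + 2) m; last by lia.
have := cardsUI (L (n - 2).-1) (L (n - 2).+1).
rewrite neighbor_layers_cover ?cardsT ?card_ord //; last by lia.
by rewrite (_ : (n - 2).-1 = n - 3) 1?(_ : (n - 2).+1 = n - 1); lia.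
Qed.

Lemma layer_code_card_ge :
  (n + 3) %/ 3 * (m + 2) <= \sum_(1 <= j < n.+1) #|L j| + 2.
Proof.
apply: sum_layer_sizes_ge => //.
- exact: first_layer_full.
- exact: second_layer_ge3.
- exact: three_layers_ge.
- exact: penultimate_layer_ge3.
- exact: last_layer_full.
- exact: last_four_layers_ge.
Qed.

End LowerBound.

(** * Upper bound: a periodic code *)

Lemma cards_minus1_ge2 (T : finType) (A : {set T}) (a b c i : T) :
  a != b -> a != c -> b != c -> a \in A -> b \in A -> c \in A ->
  2 <= #|A :\ i|.
Proof.
move=> ab ac bc aA bA cA.
have two u v : u != v -> u \in A -> v \in A -> u != i -> v != i -> 2 <= #|A :\ i|.
  move=> uv uA vA ui vi; apply: (@leq_trans #|[set u; v]|); first by rewrite cards2 uv.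
  by apply/subset_leq_card/subsetP => z /set2P[] ->; rewrite !inE ?ui ?vi.
have [ai|ai] := eqVneq a i.
  by apply: (two b c) => //; rewrite -ai eq_sym.
have [bi|bi] := eqVneq b i; last exact: (two a b).
by apply: (two a c) => //; rewrite -bi eq_sym.
Qed.

Section UpperBound.

Variables (m n : nat) (x y w : 'I_m).
Hypotheses (xy : x != y) (xw : x != w) (yw : y != w) (n7 : 6 < n).

(** The quotient [j.+1 %/ 3] is constant on layers 3t - 1, 3t, 3t + 1, so two small layers between
    full ones get the same mark, which changes across the full layer. *)
Definition block_mark (j : nat) : 'I_m := if odd (j.+1 %/ 3) then x else y.

(* A full layer every three layers.  The two layers before and after a full one
   must contain three distinct elements in total, while the two layers between
   consecutive full ones must share one: the shared mark alternates between [x]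
   and [y] from one block to the next. *)
Definition small_layers (j : nat) : {set 'I_m} :=
  if (j == 0) || (n < j) then set0
  else if (j %% 3 == 1) || (j == n) then setT
  else if (j == 2) || (j.+1 == n) then [set x; y; w]
  else if j %% 3 == 2 then [set block_mark j; w]
  else [set block_mark j].

Lemma block_mark_or (j : nat) : block_mark j = x \/ block_mark j = y.
Proof. by rewrite /block_mark; case: odd; [left|right]. Qed.

Lemma block_mark_neq (j : nat) : block_mark j != w.
Proof. by have [->|->] := block_mark_or j. Qed.

Lemma block_mark_in (j : nat) : 0 < j <= n -> block_mark j \in small_layers j.
Proof.
move=> jn; rewrite /small_layers.
have -> : (j == 0) || (n < j) = false by lia.
case: ifP => _; first by rewrite inE.
case: ifP => _; first by have [->|->] := block_mark_or j; rewrite !inE eqxx ?orbT.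
by case: ifP => _; rewrite !inE eqxx.
Qed.

Lemma extra_in (j : nat) : 0 < j <= n -> j %% 3 = 2 -> w \in small_layers j.
Proof.
move=> jn j2; rewrite /small_layers.
have -> : (j == 0) || (n < j) = false by lia.
case: ifP => _; first by rewrite inE.
case: ifP => _; first by rewrite !inE eqxx ?orbT.
by rewrite j2 /= !inE eqxx orbT.
Qed.

Lemma small_layers_full (j : nat) : 0 < j <= n -> (j %% 3 = 1) \/ (j = n) ->
  small_layers j = setT.
Proof.
move=> jn h; rewrite /small_layers.
have -> : (j == 0) || (n < j) = false by lia.
by have -> : (j %% 3 == 1) || (j == n) by case: h => ->; rewrite ?eqxx ?orbT.
Qed.

Lemma small_layers_end (j : nat) : (j = 2) \/ (j.+1 = n) ->
  [set x; y; w] \subset small_layers j.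
Proof.
move=> h; rewrite /small_layers.
have -> : (j == 0) || (n < j) = false by lia.
case: ifP => _; first exact: subsetT.
by have -> : (j == 2) || (j.+1 == n) by lia.
Qed.

Lemma small_layers_code : layer_code n small_layers.
Proof.
have ge2 (j : nat) i : 0 < j <= n -> (j %% 3 = 1) \/ (j = n) ->
    2 <= #|small_layers j :\ i|.
  by move=> jn h; rewrite small_layers_full //;
    apply: (@cards_minus1_ge2 _ _ x y w); rewrite ?inE.
have ge2' (j : nat) i : (j = 2) \/ (j.+1 = n) -> 2 <= #|small_layers j :\ i|.
  move=> /small_layers_end/subsetP h.
  by apply: (@cards_minus1_ge2 _ _ x y w) => //; apply: h; rewrite !inE eqxx ?orbT.
have left_full (j : nat) : 0 < j <= n -> j %% 3 = 2 -> small_layers j.-1 = setT.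
  by move=> jn j2; apply: small_layers_full; lia.
have right_full (j : nat) : 0 < j < n -> j %% 3 = 0 -> small_layers j.+1 = setT.
  by move=> jn j2; apply: small_layers_full; lia.
have notfull i (j : nat) : 0 < j <= n -> i \notin small_layers j ->
    (j %% 3 = 2 \/ j %% 3 = 0) /\ j < n.
  move=> jn iL.
  have [/eqP j1|j1] := boolP (j %% 3 == 1).
    by rewrite small_layers_full ?inE // in iL; left.
  have [jn'|jn'] := eqVneq j n; last by lia.
  by rewrite small_layers_full ?inE // in iL; right.
split.
- move=> i j jn.
  have [/eqP j2|j2] := boolP (j %% 3 == 2).
    by rewrite (leq_trans _ (leq_addr _ _)) // ge2 //; lia.
  have [ejn|nj] := eqVneq j n.
    by rewrite (leq_trans _ (leq_addr _ _)) // ge2' //; lia.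
  have [/eqP j0|j0] := boolP (j %% 3 == 0).
    by rewrite (leq_trans _ (leq_addl _ _)) // ge2 //; lia.
  have [ej1|j1] := eqVneq j 1.
    by rewrite (leq_trans _ (leq_addl _ _)) // ge2' //; lia.
  (* Only an interior full layer remains. Its neighbouring layers contain two different marks and
     [w], and deleting [i] leaves two of these three indices. *)
  have marks : block_mark j.-1 != block_mark j.+1.
    rewrite /block_mark prednK; last by lia.
    have -> : j.+2 %/ 3 = (j %/ 3).+1 by lia.
    by rewrite /=; case: odd => //=; rewrite eq_sym.
  have A1 : block_mark j.-1 \in small_layers j.-1 by apply: block_mark_in; lia.
  have B1 : block_mark j.+1 \in small_layers j.+1 by apply: block_mark_in; lia.
  have Bw : w \in small_layers j.+1 by apply: extra_in; lia.
  have [ei|ni] := eqVneq i (block_mark j.-1).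
    rewrite (leq_trans _ (leq_addl _ _)) //.
    apply: (@leq_trans #|[set block_mark j.+1; w]|).
      by rewrite cards2 block_mark_neq.
    apply/subset_leq_card/subsetP => z /set2P[] ->; rewrite !inE ?B1 ?Bw ei.
      by rewrite eq_sym marks.
    by rewrite eq_sym block_mark_neq.
  apply: (@leq_add 1 1); apply/card_gt0P.
    by exists (block_mark j.-1); rewrite !inE eq_sym ni.
  have [iw|iw] := eqVneq i w; last by exists w; rewrite !inE eq_sym iw.
  by exists (block_mark j.+1); rewrite !inE iw block_mark_neq.
- move=> i j jn /notfull[] // [j2|j0] lt_jn.
    by rewrite left_full // setTU subsetT.
  by rewrite right_full ?setUT ?subsetT //; lia.
- move=> i j j0 jn /notfull[]; first by lia.
  case=> [j2|j3] lt_jn; rewrite -card_gt0.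
    by apply: ltnW; apply: ge2; lia.
  have A1 : block_mark j.-1 \in small_layers j.-1 by apply: block_mark_in; lia.
  have Aw : w \in small_layers j.-1 by apply: extra_in; lia.
  apply/card_gt0P.
  have [iw|iw] := eqVneq i w; last by exists w; rewrite !inE eq_sym iw.
  by exists (block_mark j.-1); rewrite !inE iw block_mark_neq.
- move=> i j jn iL; have [||h lt_jn] := @notfull i j; [lia|by []|].
  rewrite -card_gt0; case: h => [j2|j3]; last by apply: ltnW; apply: ge2; lia.
  have B1 : block_mark j.+1 \in small_layers j.+1 by apply: block_mark_in; lia.
  (* Layer [j.+1] may consist of its mark alone. Layer [j] has the same mark but misses [i], so the
     mark is not [i]. *)
  have bb : block_mark j.+1 = block_mark j.
    by rewrite /block_mark; have -> : j.+2 %/ 3 = j.+1 %/ 3 by lia.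
  apply/card_gt0P; exists (block_mark j.+1); rewrite !inE B1 andbT bb.
  by apply: contraNneq iL => <-; apply: block_mark_in; lia.
Qed.

(** The three quotients count the layers up to [q] congruent to 1, 2 and 0 modulo 3. *)
Lemma sum_period3 (q : nat) :
  \sum_(1 <= j < q.+1) (if j %% 3 == 1 then m else if j %% 3 == 2 then 2 else 1)
  = (q + 2) %/ 3 * m + (q + 1) %/ 3 * 2 + q %/ 3.
Proof.
elim: q => [|q IH]; first by rewrite big_nil.
rewrite big_nat_recr //= IH.
have [e|ne] := eqVneq (q.+1 %% 3) 1.
  have -> : (q.+1 + 2) %/ 3 = ((q + 2) %/ 3).+1 by lia.
  by lia.
have -> : (q.+1 + 2) %/ 3 = (q + 2) %/ 3 by lia.
by case: eqP; lia.
Qed.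

Lemma sum_small_layers_le :
  \sum_(1 <= j < n.+1) #|small_layers j| <= (n + 3) %/ 3 * (m + 3) + m.
Proof.
have m_ge (A : {set 'I_m}) : #|A| <= m by have := max_card (mem A); rewrite card_ord.
have le3 : #|[set x; y; w]| <= 3.
  by rewrite setUC cardsU1 cards2; case: (_ \notin _); case: (_ != _).
(* Before the last two layers the sizes follow the period m, 2, 1; the term [j == 2] pays for the
   third element of layer 2. *)
have bound (j : nat) : 0 < j < n.-1 -> #|small_layers j| <=
    (if j %% 3 == 1 then m else if j %% 3 == 2 then 2 else 1) + (j == 2).
  move=> jn; rewrite /small_layers.
  have -> : (j == 0) || (n < j) = false by lia.
  have -> : (j == n) = false by lia.
  have -> : (j.+1 == n) = false by lia.
  rewrite !orbF; case: ifP => _; first by rewrite (leq_trans (m_ge _)) ?leq_addr.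
  have [->//|_] := eqVneq j 2.
  by case: ifP => _; rewrite addn0 ?cards1 // cards2; case: (_ != _).
have pen : #|small_layers n.-1| <= if n.-1 %% 3 == 1 then m else 3.
  rewrite /small_layers prednK; last by lia.
  have -> : (n.-1 == 0) || (n < n.-1) = false by lia.
  have -> : (n.-1 == n) = false by lia.
  by rewrite orbF eqxx orbT; case: ifP.
have [q nq] : exists q, n = q.+2 by exists n.-2; lia.
have lastn := m_ge (small_layers n).
have first_sum : \sum_(1 <= j < q.+1) #|small_layers j| <=
    (q + 2) %/ 3 * m + (q + 1) %/ 3 * 2 + q %/ 3 + 1.
  rewrite -sum_period3.
  apply: (@leq_trans (\sum_(1 <= j < q.+1)
    ((if j %% 3 == 1 then m else if j %% 3 == 2 then 2 else 1) + (j == 2)))).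
    rewrite big_nat [leqRHS]big_nat; apply: leq_sum => j jq.
    by apply: bound; lia.
  rewrite big_split leq_add2l /= (big_cat_nat (n := 3)) /=; [|lia|lia].
  rewrite big_ltn // big_ltn // big_geq //= big_nat big1 // => j jq.
  by case: eqP => //; lia.
move: pen lastn first_sum; rewrite nq /= => pen lastn first_sum.
rewrite big_nat_recr //= big_nat_recr //=.
move: (\sum_(_ <= _ < _) _) #|small_layers q.+1| #|small_layers q.+2|
  pen lastn first_sum => a b c.
have [k ->] : exists k, q = 3 * k + q %% 3 by exists (q %/ 3); lia.
have : q %% 3 < 3 by rewrite ltn_pmod.
case: (q %% 3) => [|[|[|//]]] _.
(* Here n = 3k + 2 and each of the last two layers counts m; the separate summand m of the bound
   absorbs one of them. *)
- have -> : (3 * k + 0).+1 %% 3 == 1 by lia.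
  have -> : (3 * k + 0 + 2) %/ 3 = k by lia.
  have -> : (3 * k + 0 + 1) %/ 3 = k by lia.
  have -> : (3 * k + 0) %/ 3 = k by lia.
  have -> : ((3 * k + 0).+2 + 3) %/ 3 = k.+1 by lia.
  by rewrite /=; nia.
- have -> : (3 * k + 1).+1 %% 3 == 1 = false by lia.
  have -> : (3 * k + 1 + 2) %/ 3 = k.+1 by lia.
  have -> : (3 * k + 1 + 1) %/ 3 = k by lia.
  have -> : (3 * k + 1) %/ 3 = k by lia.
  have -> : ((3 * k + 1).+2 + 3) %/ 3 = k.+2 by lia.
  by rewrite /=; nia.
- have -> : (3 * k + 2).+1 %% 3 == 1 = false by lia.
  have -> : (3 * k + 2 + 2) %/ 3 = k.+1 by lia.
  have -> : (3 * k + 2 + 1) %/ 3 = k.+1 by lia.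
  have -> : (3 * k + 2) %/ 3 = k by lia.
  have -> : ((3 * k + 2).+2 + 3) %/ 3 = k.+2 by lia.
  by rewrite /=; nia.
Qed.

End UpperBound.

(** * The two bounds on the code number *)

Lemma gammaSID_complete_path_ge (m n : nat) : 2 < m -> 6 < n ->
  (n + 3) %/ 3 * (m + 2) <=
  gammaSID (direct_product (complete_graph m) (path_graph n)) + 2.
Proof.
move=> m3 n7.
have [[S codeS <-] _] := gammaSIDP (code_complete_path m3 (ltac:(lia) : 1 < n)).
rewrite -(layers_of_codeK S) card_code_of_layers.
have L0 := layers_of_code_first S; have Ln1 := layers_of_code_last S.
apply: layer_code_card_ge => //.
apply: layers_separated_layer_code => //; try lia.
by apply: code_layers_separated => //; rewrite layers_of_codeK.
Qed.

Lemma gammaSID_complete_path_le (m n : nat) : 2 < m -> 6 < n ->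
  gammaSID (direct_product (complete_graph m) (path_graph n)) <=
  (n + 3) %/ 3 * (m + 3) + m.
Proof.
move=> m3 n7.
pose x : 'I_m := Ordinal (ltnW (ltnW m3)).
pose y : 'I_m := Ordinal (ltnW m3).
pose w : 'I_m := Ordinal m3.
have codeS : self_identifying_code (@code_of_layers m n (small_layers n x y w)).
  apply: layer_code_self_identifying; try lia.
  - by [].
  - by rewrite /small_layers ltnSn.
  - exact: small_layers_code.
have [_ /(_ _ codeS) le] := gammaSIDP codeS.
by apply: leq_trans le _; rewrite card_code_of_layers; apply: sum_small_layers_le.
Qed.

Import Order.TTheory GRing.Theory Num.Theory.
Local Open Scope ring_scope.

(** With q the quotient of n by d, n + 1 lies between qd + 1 and qd + d, so the ceiling is q + 1. *)
Lemma ceil_divn (n d : nat) : (0 < d)%N ->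
  Num.ceil ((n + 1)%:R / d%:R : rat) = ((n + d) %/ d)%N%:Z.
Proof.
move=> d0; have dR : 0 < d%:R :> rat by rewrite ltr0n.
have rlt := ltn_pmod n d0.
have nE : ((n + d) %/ d)%N = (n %/ d).+1 by rewrite divnDr ?dvdnn // divnn d0 addn1.
apply: ceil_def; rewrite nE ltr_pdivlMr // ler_pdivrMr //.
have -> : ((n %/ d).+1%:Z - 1)%R = (n %/ d)%N%:Z by lia.
rewrite -!pmulrn -!natrM ltr_nat ler_nat {2 3}(divn_eq n d).
by apply/andP; split; lia.
Qed.

Theorem theorem6 (m n : nat) (hm : (3 <= m)%N) (hn : (7 <= n)%N) :
  let t : int := Num.ceil ((n + 1)%:R / 3%:R : rat) in
  let g : int := (gammaSID (direct_product (complete_graph m) (path_graph n)))%:Z in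
  t * (m + 2)%:Z - 2 <= g /\ g <= t * (m + 3)%:Z + m%:Z.
Proof.
move=> t g; rewrite {}/t {}/g ceil_divn // -!PoszM -PoszD lez_nat.
split; last exact: gammaSID_complete_path_le.
by rewrite lerBlDr -PoszD lez_nat gammaSID_complete_path_ge.
Qed.
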